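(* Let $q$ be a prime power and let $n,k,n',k'\in\mathbb{N}$ satisfy $1\le k\le n/2$, $1\le k'\le n'$, and $1\le k-k'\le n-n'$. Let $\mathcal{A}=\dot\bigcup_{1\le i\le l}\mathcal{A}_i$ and $\mathcal{B}=\dot\bigcup_{1\le i\le l}\mathcal{B}_i$ be disjoint unions, where $\emptyset\ne\mathcal{A}_i\subseteq\mathcal{G}_q(n',k')$ and $\emptyset\ne\mathcal{B}_i\subseteq\mathcal{G}_q(n-n',k-k')$ for all $1\le i\le l$, and let $\overline{F}\subseteq\mathbb{F}_q^{k'\times(n-n'-k+k')}$. Then \[ \mathcal{C}\left((\mathcal{A}_i)_i,(\mathcal{B}_i)_i,\overline{F}\right):=\left\{\tau^{-1}\begin{pmatrix}A&\varphi_B(F)\\0&B\end{pmatrix}\,:\,\tau^{-1}(A)\in\mathcal{A}_i,\ \tau^{-1}(B)\in\mathcal{B}_i,\ 1\le i\le l,\ F\in\overline{F}\right\} \] is a subset of $\mathcal{G}_q(n,k)$, i.e., a constant dimension code whose codewords have dimension $k$.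
   Context: $\mathcal{G}_q(n,k)$ is the set of all $k$-dimensional subspaces of $\mathbb{F}_q^n$. The map $\tau$ is the bijection sending $U\in\mathcal{G}_q(n,k)$ to the unique $k\times n$ matrix over $\mathbb{F}_q$ of rank $k$ in reduced row echelon (RRE) form whose row space is $U$ (the same symbol $\tau$ is used for all $n,k$); thus $\tau^{-1}(M)$ is the row space of a full-rank RRE matrix $M$. For a full-rank matrix $B\in\mathbb{F}_q^{b\times m}$ in RRE form, $p(B)=(v_1,\dots,v_m)\in\{0,1\}^m$ is its pivot vector, i.e. $v_i=1$ if and only if column $i$ is a pivot column of $B$. For $F\in\mathbb{F}_q^{k'\times(m-b)}$ with columns $f^1,\dots,f^{m-b}$, $\varphi_B(F)$ is the $k'\times m$ matrix whose $i$-th column is $\mathbf{0}$ if $v_i=1$ and is $f^{\,i-s_i}$ otherwise, where $s_i=\sum_{j=1}^i v_j$ (i.e. zero columns are inserted at the pivot positions of $B$). *)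

(* Defs.v *)
From mathcomp Require Import all_boot all_order all_algebra.
From mathcomp Require Import classical_sets.

Set Implicit Arguments.
Unset Strict Implicit.
Unset Printing Implicit Defensive.

Import GRing.Theory.
Local Open Scope ring_scope.

Definition prime_power (q : nat) : Prop :=
  exists p e : nat, [/\ prime p, (0 < e)%N & q = (p ^ e)%N].

Definition Gq (F : finFieldType) (n k : nat) : set {vspace 'rV[F]_n} :=
  [set U | \dim U = k]%classic.

Arguments Gq F n k : clear implicits.

Definition leading (F : fieldType) (k n : nat) (M : 'M[F]_(k, n))
    (i : 'I_k) (j : 'I_n) : bool :=
  (M i j != 0) && [forall j' : 'I_n, (j' < j)%N ==> (M i j' == 0)].

(* The first conjunct says both that zero rows come last and that the leading
   entries move strictly to the right; the second says that a column holding
   the leading entry of row i is the i-th unit vector, so leading entries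
   are 1. *)
Definition rref (F : fieldType) (k n : nat) (M : 'M[F]_(k, n)) : bool :=
  [forall i1 : 'I_k, forall i2 : 'I_k, forall j2 : 'I_n,
     (i1 < i2)%N && leading M i2 j2 ==>
       [exists j1 : 'I_n, leading M i1 j1 && (j1 < j2)%N]]
  && [forall i : 'I_k, forall j : 'I_n,
        leading M i j ==> (col j M == delta_mx i 0)].

(* The matrices tau(U), for U a k-dimensional subspace of F^n. *)
Definition full_rref (F : fieldType) (k n : nat) (M : 'M[F]_(k, n)) : bool :=
  (\rank M == k) && rref M.

(* The row space. It is the inverse of tau on matrices satisfying [full_rref];
   elsewhere the value does not represent tau^-1, so every use has to be
   accompanied by [full_rref]. *)
Definition tau_inv (F : fieldType) (k n : nat) (M : 'M[F]_(k, n)) :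
    {vspace 'rV[F]_n} :=
  <<[seq row i M | i : 'I_k]>>%VS.

Definition pivot_vector (F : fieldType) (b m : nat) (B : 'M[F]_(b, m)) :
    {ffun 'I_m -> bool} :=
  [ffun j => [exists i : 'I_b, leading B i j]].

Definition pivots_upto (F : fieldType) (b m : nat) (B : 'M[F]_(b, m))
    (i : 'I_m) : nat :=
  (\sum_(j < m | j <= i) pivot_vector B j)%N.

(* At a non-pivot column, the formula i - s_i for the column of M is the same
   for 0-based and 1-based numbering. It is always a valid index when B
   satisfies [full_rref]; the value 0 for an invalid index is then unused. *)
Definition phi (F : fieldType) (b m k' : nat) (B : 'M[F]_(b, m))
    (M : 'M[F]_(k', m - b)) : 'M[F]_(k', m) :=
  \matrix_(r < k', i < m)
    if pivot_vector B i then 0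
    else if insub (i - pivots_upto B i)%N is Some j then M r j else 0.

Lemma subnKC_gt0 (a b : nat) : (1 <= b - a)%N -> (a + (b - a))%N = b.
Proof. by rewrite subn_gt0 => /ltnW/subnKC. Qed.

(* The casts identify k' + (k - k') with k and n' + (n - n') with n. *)
Definition code_matrix (F : fieldType) (n k n' k' : nat)
    (ek : (k' + (k - k'))%N = k) (en : (n' + (n - n'))%N = n)
    (A : 'M[F]_(k', n')) (B : 'M[F]_(k - k', n - n'))
    (M : 'M[F]_(k', n - n' - (k - k'))) : 'M[F]_(k, n) :=
  castmx (ek, en) (block_mx A (phi B M) 0 B).

Definition code_matrices (F : finFieldType) (n k n' k' l : nat)
    (ek : (k' + (k - k'))%N = k) (en : (n' + (n - n'))%N = n)
    (A_ : 'I_l -> set {vspace 'rV[F]_n'})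
    (B_ : 'I_l -> set {vspace 'rV[F]_(n - n')})
    (Fbar : set 'M[F]_(k', n - n' - (k - k'))) : set 'M[F]_(k, n) :=
  [set X | exists (i : 'I_l) (A : 'M[F]_(k', n'))
             (B : 'M[F]_(k - k', n - n')) (M : 'M[F]_(k', n - n' - (k - k'))),
     [/\ full_rref A /\ A_ i (tau_inv A),
         full_rref B /\ B_ i (tau_inv B),
         Fbar M & X = code_matrix ek en A B M]]%classic.

Definition code (F : finFieldType) (n k n' k' l : nat)
    (ek : (k' + (k - k'))%N = k) (en : (n' + (n - n'))%N = n)
    (A_ : 'I_l -> set {vspace 'rV[F]_n'})
    (B_ : 'I_l -> set {vspace 'rV[F]_(n - n')})
    (Fbar : set 'M[F]_(k', n - n' - (k - k'))) : set {vspace 'rV[F]_n} :=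
  (@tau_inv F k n @` code_matrices ek en A_ B_ Fbar)%classic.

(* Main.v *)
Require Import Defs.
From mathcomp Require Import all_boot all_order all_algebra.
From mathcomp Require Import classical_sets.

Set Implicit Arguments.
Unset Strict Implicit.
Unset Printing Implicit Defensive.

Import GRing.Theory.
Local Open Scope ring_scope.

(** The row space of a [k x n] matrix of rank [k] has dimension [k], so the
    only real question is whether [block_mx A (phi B M) 0 B] is again a
    full-rank reduced row echelon matrix; the block matrix with an
    arbitrary corner in place of [phi B M] would have full rank, but would in
    general not be reduced.

    As [A] has full rank, each of its rows has a leading entry, so each upper
    row of the block matrix starts inside the left block, and each lower row
    starts inside the right one.  Hence the leading entries of the block matrix
    are those of [A] followed by those of [B] ([leading_block_ul] and its three
    companions), and they move to the right.  The column of a leading entry of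
    [A] is a unit column because the block below [A] is zero.  The column of a
    leading entry of [B] is a unit column because [phi B M] was built to vanish
    on the pivot columns of [B].  This is [full_rref_block]. *)

Section Leading.
Variable F : fieldType.

Lemma row_has_leading k n (A : 'M[F]_(k, n)) (i : 'I_k) :
  row i A != 0 -> exists j, leading A i j.
Proof.
case/rV0Pn => j0; rewrite mxE => nz0.
case: (arg_minnP (P := fun j => A i j != 0) (@nat_of_ord n) nz0) => j nz jmin.
exists j; rewrite /leading nz; apply/forallP => j'; apply/implyP => lt_j'j.
by apply: contraTT lt_j'j; rewrite -leqNgt => /jmin.
Qed.

Lemma row_free_has_leading k n (A : 'M[F]_(k, n)) (i : 'I_k) :
  row_free A -> exists j, leading A i j.
Proof.
move=> freeA; apply: row_has_leading.
apply/eqP; rewrite rowE => /eqP; rewrite mulmx_free_eq0 // => /eqP/rowP/(_ i).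
by rewrite !mxE !eqxx => /eqP; rewrite oner_eq0.
Qed.

Variables (k1 k2 n1 n2 : nat).
Variables (A : 'M[F]_(k1, n1)) (D : 'M[F]_(k1, n2)) (B : 'M[F]_(k2, n2)).
Let X := block_mx A D 0 B.

Lemma leading_block_ul i j : leading X (lshift k2 i) (lshift n2 j) = leading A i j.
Proof.
rewrite /leading block_mxEul; congr (_ && _).
apply/forallP/forallP => H j'.
  by have := H (lshift n2 j'); rewrite block_mxEul.
case: (split_ordP j') => j1 -> /=; first by rewrite block_mxEul; exact: H.
by apply/implyP; rewrite ltnNge (leq_trans (ltnW (ltn_ord j)) (leq_addr _ _)).
Qed.

Lemma leading_block_ur i j :
  row_free A -> leading X (lshift k2 i) (rshift n1 j) = false.
Proof.
case/(row_free_has_leading i) => j1 /andP[nz _].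
apply/negP => /andP[_ /forallP/(_ (lshift n2 j1))/implyP].
rewrite block_mxEul (negbTE nz) => H.
by have := H (leq_trans (ltn_ord j1) (leq_addr _ _)).
Qed.

Lemma leading_block_dl i j : leading X (rshift k1 i) (lshift n2 j) = false.
Proof. by rewrite /leading block_mxEdl mxE eqxx. Qed.

Lemma leading_block_dr i j : leading X (rshift k1 i) (rshift n1 j) = leading B i j.
Proof.
rewrite /leading block_mxEdr; congr (_ && _).
apply/forallP/forallP => H j'.
  by have := H (rshift n1 j'); rewrite block_mxEdr /= ltn_add2l.
case: (split_ordP j') => j1 -> /=.
  by rewrite block_mxEdl mxE eqxx implybT.
by rewrite block_mxEdr ltn_add2l; exact: H.
Qed.

End Leading.

Lemma row_free_block_triangular (F : fieldType) k1 k2 n1 n2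
    (A : 'M[F]_(k1, n1)) (D : 'M[F]_(k1, n2)) (B : 'M[F]_(k2, n2)) :
  row_free A -> row_free B -> row_free (block_mx A D 0 B).
Proof.
move=> freeA freeB; apply: inj_row_free => v.
rewrite -[v]hsubmxK mul_row_block mulmx0 addr0 -[0 in RHS]row_mx0.
case/eq_row_mx => /eqP; rewrite mulmx_free_eq0 // => /eqP ->.
rewrite mul0mx add0r => /eqP; rewrite mulmx_free_eq0 // => /eqP ->.
by rewrite row_mx0.
Qed.

(** The hypothesis on [D] is the reducedness that the blocks [A] and [B] cannot
    provide: above the leading entries of [B] there must be zeros. *)
Lemma full_rref_block (F : fieldType) k1 k2 n1 n2
    (A : 'M[F]_(k1, n1)) (D : 'M[F]_(k1, n2)) (B : 'M[F]_(k2, n2)) :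
  full_rref A -> full_rref B ->
  (forall j, pivot_vector B j -> col j D = 0) ->
  full_rref (block_mx A D 0 B).
Proof.
case/andP => freeA /andP[/forallP stairA /forallP unitA].
case/andP => freeB /andP[/forallP stairB /forallP unitB] D0.
apply/andP; split; first exact: row_free_block_triangular.
apply/andP; split; apply/forallP => i1.
- apply/forallP => i2; apply/forallP => j2; apply/implyP => /andP[].
  case: (split_ordP i1) => {}i1 ->; case: (split_ordP i2) => {}i2 -> /=;
    case: (split_ordP j2) => {}j2 -> lt_i.
  + rewrite leading_block_ul => lead2.
    have /forallP/(_ i2)/forallP/(_ j2) := stairA i1.
    rewrite lt_i lead2 => /existsP[j1 /andP[lead1 lt_j]].
    by apply/existsP; exists (lshift n2 j1); rewrite leading_block_ul lead1.
  + by rewrite leading_block_ur.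
  + by rewrite leading_block_dl.
  + (* An upper row against a lower one: the former starts in the columns of
       [A], which precede all columns of [B]. *)
    move=> _; have [j1 lead1] := row_free_has_leading i1 freeA.
    apply/existsP; exists (lshift n2 j1); rewrite leading_block_ul lead1 /=.
    exact: leq_trans (ltn_ord j1) (leq_addr _ _).
  + by move: lt_i; rewrite ltnNge (leq_trans (ltnW (ltn_ord i2)) (leq_addr _ _)).
  + by move: lt_i; rewrite ltnNge (leq_trans (ltnW (ltn_ord i2)) (leq_addr _ _)).
  + by rewrite leading_block_dl.
  + rewrite leading_block_dr => lead2; rewrite ltn_add2l in lt_i.
    have /forallP/(_ i2)/forallP/(_ j2) := stairB i1.
    rewrite lt_i lead2 => /existsP[j1 /andP[lead1 lt_j]].
    apply/existsP; exists (rshift n1 j1).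
    by rewrite leading_block_dr lead1 /= ltn_add2l.
- apply/forallP => j; apply/implyP.
  case: (split_ordP i1) => {}i1 ->; case: (split_ordP j) => {}j ->.
  + rewrite leading_block_ul => lead1.
    have /forallP/(_ j) := unitA i1; rewrite lead1 => /eqP/colP colA.
    apply/eqP/colP => i; case: (split_ordP i) => {}i ->; rewrite mxE.
      by rewrite block_mxEul; have := colA i; rewrite !mxE (inj_eq (@lshift_inj _ _)).
    by rewrite block_mxEdl !mxE eq_rlshift.
  + by rewrite leading_block_ur.
  + by rewrite leading_block_dl.
  + rewrite leading_block_dr => lead1.
    have /D0/colP colD : pivot_vector B j by rewrite ffunE; apply/existsP; exists i1.
    have /forallP/(_ j) := unitB i1; rewrite lead1 => /eqP/colP colB.
    apply/eqP/colP => i; case: (split_ordP i) => {}i ->; rewrite mxE.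
      by rewrite block_mxEur; have := colD i; rewrite !mxE eq_lrshift.
    by rewrite block_mxEdr; have := colB i; rewrite !mxE (inj_eq (@rshift_inj _ _)).
Qed.

Lemma col_phi_pivot (F : fieldType) b m k' (B : 'M[F]_(b, m))
    (M : 'M[F]_(k', m - b)) j : pivot_vector B j -> col j (phi B M) = 0.
Proof. by move=> pivj; apply/colP => r; rewrite !mxE pivj. Qed.

Lemma full_rref_castmx (F : fieldType) k1 k2 n1 n2 (ek : k1 = k2) (en : n1 = n2)
    (X : 'M[F]_(k1, n1)) : full_rref (castmx (ek, en) X) = full_rref X.
Proof. by case: _ / ek; case: _ / en; rewrite castmx_id. Qed.

Lemma dim_tau_inv (F : fieldType) k n (X : 'M[F]_(k, n)) :
  row_free X -> \dim (tau_inv X) = k.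
Proof.
move=> freeX; pose rows := [tuple row i X | i < k].
suff /eqP : free rows by rewrite size_tuple.
apply/freeP => c c0 i; pose u := \row_j c j.
have /eqP : u *m X = 0.
  rewrite mulmx_sum_row -[RHS]c0; apply: eq_bigr => j _; rewrite -tnth_nth.
  by rewrite mxE tnth_mktuple.
by rewrite mulmx_free_eq0 // => /eqP/rowP/(_ i); rewrite !mxE.
Qed.

Theorem lemma3 (q : nat) (hq : prime_power q)
    (F : finFieldType) (hF : #|F| = q)
    (n k n' k' : nat)
    (hk : (1 <= k)%N) (hkn : (2 * k <= n)%N)
    (hk' : (1 <= k')%N) (hkn' : (k' <= n')%N)
    (hkk : (1 <= k - k')%N) (hkknn : (k - k' <= n - n')%N)
    (l : nat)
    (AA : set {vspace 'rV[F]_n'}) (A_ : 'I_l -> set {vspace 'rV[F]_n'})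
    (BB : set {vspace 'rV[F]_(n - n')})
    (B_ : 'I_l -> set {vspace 'rV[F]_(n - n')})
    (hAA : (AA = \bigcup_(i in [set: 'I_l]) A_ i)%classic)
    (hBB : (BB = \bigcup_(i in [set: 'I_l]) B_ i)%classic)
    (hAdisj : trivIset [set: 'I_l]%classic A_)
    (hBdisj : trivIset [set: 'I_l]%classic B_)
    (hA0 : forall i : 'I_l, A_ i <> set0%classic)
    (hB0 : forall i : 'I_l, B_ i <> set0%classic)
    (hA : forall i : 'I_l, (A_ i `<=` Gq F n' k')%classic)
    (hB : forall i : 'I_l, (B_ i `<=` Gq F (n - n') (k - k'))%classic)
    (Fbar : set 'M[F]_(k', n - n' - (k - k'))) :
  let ek := subnKC_gt0 hkk in
  let en := subnKC_gt0 (leq_trans hkk hkknn) in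
  (code_matrices ek en A_ B_ Fbar `<=` [set X | full_rref X])%classic /\
  (code ek en A_ B_ Fbar `<=` Gq F n k)%classic.
Proof.
move=> ek en.
have rrefC : (code_matrices ek en A_ B_ Fbar `<=` [set X | full_rref X])%classic.
  move=> _ [i [A [B [M [[rrefA _] [rrefB _] _ ->]]]]] /=.
  rewrite /code_matrix full_rref_castmx full_rref_block // => j.
  exact: col_phi_pivot.
split=> // _ [X /rrefC /andP[freeX _] <-]; exact: dim_tau_inv.
Qed.
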